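(* Let $X$ be an open subspace of a completely regular $\Pi$-separable space. Then: (1) $X$ is a Baire space if and only if $X$ is an $\mathcal{N}$-space. (2) $X$ is non-meager in itself if and only if $X$ is a g$\mathcal{N}$-space.
   Context: No separation axioms are assumed unless stated; ''compact'' means every open cover has a finite subcover. A space is $\Pi$-separable if it is homeomorphic to the product of a family of separable spaces. Completely regular (not necessarily $T_1$): for every point $x$ and neighborhood $U$ of $x$ there is a continuous $[0,1]$-valued function vanishing at $x$ and equal to $1$ off $U$. A set is meager if it is a countable union of sets whose closures have empty interior; $X$ is Baire if no non-void open subset is meager in $X$. $X$ is an $\mathcal{N}$-space if for every compact space $Y$ and every separately continuous $f\colon X\times Y\to\mathbb{R}$ there is a dense set $R\subseteq X$ such that $f$ is jointly continuous at each point of $R\times Y$. $X$ is a g$\mathcal{N}$-space if for every compact space $Y$ and every separately continuous $f\colon X\times Y\to\mathbb{R}$ there is at least one point $x\in X$ such that $f$ is jointly continuous at each point of $\{x\}\times Y$. *)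

(* Defs.v *)
From HB Require Import structures.
From mathcomp Require Import all_boot all_order all_algebra.
From mathcomp Require Import all_classical all_reals all_analysis.

Set Implicit Arguments.
Unset Strict Implicit.
Unset Printing Implicit Defensive.

Import Order.TTheory GRing.Theory Num.Theory.
Import numFieldNormedType.Exports.

Local Open Scope classical_set_scope.
Local Open Scope ring_scope.

Definition separable_space (T : topologicalType) : Prop :=
  exists D : set T, countable D /\ dense D.

Definition homeomorphic (S T : topologicalType) : Prop :=
  exists (f : S -> T) (g : T -> S),
    [/\ continuous f, continuous g, cancel f g & cancel g f].

Definition Pi_separable (T : topologicalType) : Prop :=
  exists (I : Type) (K : I -> topologicalType),
    (forall i, separable_space (K i)) /\ homeomorphic T (prod_topology K).

(* The library's [completely_regular_space] is phrased with
   [uniform_separator] and does not include T1; this is the usual definition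
   by real-valued functions. *)
Lemma completely_regular_spaceP (R : realType) (T : topologicalType) :
  completely_regular_space T <->
  forall (x : T) (U : set T), nbhs x U ->
    exists f : T -> R, [/\ continuous f, forall z, f z \in `[0, 1],
      f x = 0 & forall z, ~ U z -> f z = 1].
Proof.
split=> [crT x U|H a B cB nBa].
  rewrite nbhsE => -[V [oV Vx] VU].
  have /(@uniform_separatorP T R)[f [cf f01 f0 f1]] :=
    crT x (~` V) (open_closedC oV) (fun nVx => nVx Vx).
  exists f; split=> // [z||z nUz]; first by apply: f01; exists z.
    by apply: f0; exists x.
  by apply: f1; exists z => // Vz; apply: nUz; exact: VU.
apply/(@uniform_separatorP T R).
have nBn : nbhs a (~` B).
  by apply: open_nbhs_nbhs; split=> //; exact: closed_openC.
have [f [cf f01 f0 f1]] := H a _ nBn.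
exists f; split=> //.
- by move=> _ [z _ <-]; exact: f01.
- by move=> _ [z -> <-].
- by move=> _ [z Bz <-]; apply: f1 => /(_ Bz).
Qed.

Definition nowhere_dense (T : topologicalType) (A : set T) : Prop :=
  (closure A)° = set0.

Definition meager (T : topologicalType) (A : set T) : Prop :=
  exists F : nat -> set T,
    (forall n, nowhere_dense (F n)) /\ A = \bigcup_n F n.

Definition Baire_space (T : topologicalType) : Prop :=
  forall U : set T, open U -> U !=set0 -> ~ meager U.

Definition separately_continuous (S T U : topologicalType) (f : S * T -> U)
    : Prop :=
  (forall x, continuous (fun y => f (x, y))) /\
  (forall y, continuous (fun x => f (x, y))).

Definition N_space (R : realType) (X : topologicalType) : Prop :=
  forall (Y : topologicalType) (f : X * Y -> R),
    compact [set: Y] -> separately_continuous f ->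
    exists D : set X, dense D /\
      forall x y, D x -> {for (x, y), continuous f}.

Definition gN_space (R : realType) (X : topologicalType) : Prop :=
  forall (Y : topologicalType) (f : X * Y -> R),
    compact [set: Y] -> separately_continuous f ->
    exists x : X, forall y, {for (x, y), continuous f}.

(* Main.v *)
Require Import Defs.
From mathcomp Require Import all_boot all_order all_algebra.
From mathcomp Require Import all_classical all_reals all_analysis.
From mathcomp Require Import ring lra.

Set Implicit Arguments.
Unset Strict Implicit.
Unset Printing Implicit Defensive.

Import Order.TTheory GRing.Theory Num.Theory.
Import numFieldNormedType.Exports.

Local Open Scope classical_set_scope.
Local Open Scope ring_scope.

(** Both parts rest on one fact in each direction.

    From category to joint continuity.  Let [f] be separately continuous on
    [X * Y] with [Y] compact.  If [x] has, for each [e > 0], an open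
    neighborhood on which all the functions [f(-, y)] oscillate by at most [e],
    then [f] is jointly continuous at each point of [{x} * Y].  So it suffices
    that every non-meager open set [U] contains a nonempty open set of
    uniformly small oscillation ([nonmeager_small_oscillation]): the bad points
    then form a meager set ([meager_joint_discontinuity]), whose complement is
    dense when [X] is Baire and nonempty when [X] is non-meager.

    For [U] open in a product of separable spaces, suppose that there is no
    such open subset.  Then, inside any nonempty open part of [U] and for any
    finite set of test points, there are [y], [y'] that [f] hardly
    distinguishes at the test points, and a smaller open set on which
    [f(-, y)] and [f(-, y')] stay [e] apart
    ([small_oscillation_or_separation]).  Iterating gives decreasing open sets
    [B_n], each depending on finitely many coordinates, and pairs
    [(y_n, y'_n)].  As [U] is non-meager, the choices can be made so that the
    [B_n] have a common point ([oxtoby]).  Only the countable set [J] of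
    coordinates used by the [B_n] matters, so this point may be reset to a
    fixed base point [a] off [J].  The resulting point [x] is in the closure of
    countably many points that equal [a] off a finite part of [J] and have
    there coordinates in fixed dense sequences; these serve as the test points,
    so that only the factors, and not the product, have to be separable.  At a
    cluster point [(y, y')] of the pairs, [f(-, y)] and [f(-, y')] agree at all
    test points, hence at [x], although they are at least [e] apart there.

    From joint continuity to category.  Let [X] be completely regular and
    [F_n] nowhere dense.  A maximal family of disjointly supported functions
    [h : X -> [0, 1]] vanishing on [F_n] has supports with dense union.
    Composing them with tents of height one, placed closer and closer to zero,
    gives continuous functions of which finitely many are nonzero at each
    point.  Each of them vanishes near every point of [F_n], but in each
    nonempty open set some of them reaches [1/2].  Scaled by [1/(n+1)] and put
    together for all [n], they are the values of a separately continuous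
    function on [X] times the one-point compactification of a discrete index
    space, and this function is discontinuous at [(x, oo)] for each [x] in some
    [F_n] ([nowhere_dense_discontinuity]). *)

(** * Meager sets and Oxtoby's argument *)

(** Zorn's lemma, in the form used both for open sets and for functions with
    disjoint supports: [O s] is the part of [X] occupied by [s]. *)
Lemma maximal_disjoint_family (S X : Type) (P : set S) (O : S -> set X) :
  exists A : set S, [/\ A `<=` P,
    forall s t, A s -> A t -> O s `&` O t !=set0 -> s = t &
    forall s, P s -> O s !=set0 -> exists2 t, A t & O s `&` O t !=set0].
Proof.
pose Q (A : set S) := A `<=` P /\
  forall s t, A s -> A t -> O s `&` O t !=set0 -> s = t.
have [|A [[AP Adisj] Amax]] := @Zorn_bigcup S Q.
  move=> F FQ Ftot; split; first by move=> s [A FA As]; exact: (FQ A FA).1.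
  move=> s t [A FA As] [B FB Bt].
  have [/(_ _ As) Bs|/(_ _ Bt) At] := Ftot A B FA FB.
    exact: (FQ B FB).2.
  exact: (FQ A FA).2.
exists A; split=> // s Ps s0; apply: contrapT => nt.
apply: (Amax (A `|` [set s])); first split.
- by left.
- have As : ~ A s.
    by move=> As; apply: nt; exists s => //; rewrite setIid.
  by move=> /(_ s (or_intror erefl)).
- split; first by move=> t [/AP//|->].
  move=> t u [At|->] [Au|->] // tu; first exact: Adisj.
    by exfalso; apply: nt; exists t => //; rewrite setIC.
  by exfalso; apply: nt; exists u.
Qed.

Lemma open_meets_closure (X : topologicalType) (A V : set X) :
  open V -> V `&` closure A !=set0 -> V `&` A !=set0.
Proof.
move=> oV [x [Vx clA]].
by rewrite setIC; apply: clA; exact: open_nbhs_nbhs.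
Qed.

(** Nowhere density without closures, which is how it is established and used
    below. *)
Lemma nowhere_denseP (X : topologicalType) (A : set X) :
  nowhere_dense A <-> (forall V, open V -> V !=set0 ->
    exists W, [/\ open W, W !=set0, W `<=` V & W `&` A = set0]).
Proof.
split=> [And V oV [v Vv]|H].
  exists (V `\` closure A); split.
  - by apply: openI => //; exact: closed_openC (@closed_closure _ _).
  - apply: contrapT => nV.
    suff : (closure A)° v by rewrite And.
    rewrite /interior nbhsE; exists V => // w Vw.
    apply: contrapT => nAw; apply: nV.
    by exists w.
  - by move=> ? [].
  - by rewrite -subset0 => w [[_ ncA] /subset_closure].
rewrite /nowhere_dense -subset0 => x Ax.
have [W [oW [w Ww] WV WA]] :=
  H _ (@open_interior _ (closure A)) (ex_intro _ x Ax).
have : W `&` A !=set0.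
  apply: open_meets_closure => //; exists w; split=> //.
  by apply: interior_subset; exact: WV.
by rewrite WA => -[].
Qed.

Lemma subset_meager (X : topologicalType) (A B : set X) :
  A `<=` B -> meager B -> meager A.
Proof.
move=> AB [F [Fnd BE]]; exists (fun n => F n `&` A); split; last first.
  by rewrite -setI_bigcupl -BE setIC; apply/esym/setIidl.
move=> n; apply/nowhere_denseP => V oV V0.
have /nowhere_denseP /(_ V oV V0) [W [oW W0 WV WF]] := Fnd n.
by exists W; split=> //; rewrite setIA WF set0I.
Qed.

(** A player who can move from [s] into any open part of [O s] inside [O s0]
    can be led to moves with a common point.  At each stage a maximal disjoint
    family of moves covers a dense part of [O s0], and since [O s0] is not
    meager some [x] is covered at all stages; disjointness makes the covering
    moves form a single branch. *)
Lemma oxtoby (X : topologicalType) (S : Type) (O : S -> set X)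
    (R : S -> S -> Prop) (s0 : S) :
  open (O s0) -> ~ meager (O s0) ->
  (forall s V, open V -> V !=set0 -> V `<=` O s -> V `<=` O s0 ->
    exists t, [/\ R s t, open (O t), O t !=set0 & O t `<=` V]) ->
  exists (s : nat -> S) (x : X), [/\ s 0%N = s0,
    forall n, R (s n) (s n.+1) & forall n, O (s n) x].
Proof.
move=> oO nmO H.
pose M s t := [/\ R s t, open (O t), O t !=set0 & O t `<=` O s `&` O s0].
have /choice[A Amax] s := maximal_disjoint_family (M s) O.
pose L := fix L (n : nat) : set S :=
  if n is m.+1 then \bigcup_(s in L m) A s else [set s0].
have AM s t : A s t -> M s t by have [h _ _] := Amax s; exact: h.
have Lopen n s : L n s -> open (O s) /\ O s `<=` O s0.
  case: n => [->|n [t _ /AM[_ oOs _ sO]]]; first by split.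
  by split=> // x /sO[].
pose W (m : nat) : set X := \bigcup_(s in L m) O s.
have Wdense n (V : set X) :
    open V -> V !=set0 -> V `<=` O s0 -> V `&` W n !=set0.
  elim: n V => [|n IHn] V oV V0 VO.
    by case: V0 => v Vv; exists v; split=> //; exists s0 => //; exact: VO.
  have [v [Vv [s Ls Osv]]] := IHn V oV V0 VO.
  have [oOs _] := Lopen _ _ Ls.
  have [|||t [Rst oOt Ot0 OtV]] := H s (V `&` O s) (openI oV oOs).
  - by exists v.
  - by move=> ? [].
  - by move=> ? [/VO].
  have [_ _ /(_ t)[||u Au [z [Otz Ouz]]]//] := Amax s.
    by split=> // z /OtV[/VO].
  exists z; split; first by case: (OtV _ Otz).
  by exists u => //; exists s.
have [x Ox Wx] : exists2 x, O s0 x & forall n, W n x.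
  apply: contrapT => nx; apply: nmO.
  exists (fun n => O s0 `\` W n); split; last first.
    apply/seteqP; split=> [x Ox|x [n _ []]//].
    apply: contrapT => nWx; apply: nx; exists x => // n.
    by apply: contrapT => nW; apply: nWx; exists n.
  move=> n; apply/nowhere_denseP => V oV V0.
  have [VO0|/set0P VO] := eqVneq (V `&` O s0) set0.
    by exists V; split=> //; rewrite setIDA VO0 set0D.
  exists (V `&` O s0 `&` W n); split.
  - apply: openI; first exact: openI.
    by apply: bigcup_open => s /Lopen[].
  - by apply: Wdense => //; exact: openI.
  - by move=> ? [[]].
  - by rewrite -subset0 => z [[_ ?] []].
have Luniq n s t : L n s -> L n t -> O s x -> O t x -> s = t.
  elim: n s t => [|n IHn] s t; first by move=> -> ->.
  move=> [s' Ls' As] [t' Lt' At] Osx Otx.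
  have [_ _ _ /(_ _ Osx)[Os'x _]] := AM _ _ As.
  have [_ _ _ /(_ _ Otx)[Ot'x _]] := AM _ _ At.
  have E := IHn _ _ Ls' Lt' Os'x Ot'x; subst t'.
  have [_ dj _] := Amax s'; apply: dj => //.
  by exists x.
have /choice[s sP] n : exists s, L n s /\ O s x.
  by have [s Ls Osx] := Wx n; exists s.
exists s, x; split.
- by have [] := sP 0%N.
- move=> n; have [[t Lt At] Osx] := sP n.+1.
  have [Ls Osnx] := sP n.
  have [Rt _ _ /(_ _ Osx)[Otx _]] := AM _ _ At.
  by rewrite (Luniq n (s n) t).
- by move=> n; have [] := sP n.
Qed.

(** * Compactness and the basic dichotomy *)

Lemma filter_all_seq (T : Type) (I : eqType) (F : set_system T)
    (P : I -> T -> Prop) (s : seq I) : Filter F ->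
  (forall i, i \in s -> \forall x \near F, P i x) ->
  \forall x \near F, forall i, i \in s -> P i x.
Proof.
move=> FF; elim: s => [|i s IHs] Ps.
  by apply: nearW => x i; rewrite in_nil.
have Pi := Ps i (mem_head _ _).
have {}IHs : \forall x \near F, forall j, j \in s -> P j x.
  by apply: IHs => j js; apply: Ps; rewrite in_cons js orbT.
by apply: filterS2 Pi IHs => x Pix Psx j; rewrite in_cons => /predU1P[->|/Psx].
Qed.

(** The family of covering sets is indexed by points, and the finite subcover is
    read off the near-covering form of compactness, applied to the filter of
    all sufficiently large finite lists. *)
Lemma compact_finite_subcover (X : topologicalType) (A : set X)
    (U : X -> set X) :
  compact A -> (forall x, A x -> nbhs x (U x)) ->
  exists s : seq X, forall y, A y -> exists2 x, x \in s & U x y.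
Proof.
move=> /compact_near_coveringP cA AU.
pose F : set_system (seq X) :=
  [set B : set (seq X) | exists s0 : seq X,
    forall s : seq X, {subset s0 <= s} -> B s].
have FF : Filter F.
  split.
  - by exists [::].
  - move=> B C [s sB] [t tC]; exists (s ++ t) => u stu; split.
      by apply: sB => z zs; apply: stu; rewrite mem_cat zs.
    by apply: tC => z zs; apply: stu; rewrite mem_cat zs orbT.
  - by move=> B C BC [s sB]; exists s => u /sB /BC.
have [|s sP] := cA _ F (fun s y => exists2 x, x \in s & U x y) FF.
  move=> x Ax; exists (U x, [set s : seq X | x \in s]).
    split=> /=; first exact: AU.
    by exists [:: x] => s; apply; rewrite mem_head.
  by move=> [y s] /= [Uxy xs]; exists x.
by exists s => y Ay; exact: (sP s).
Qed.

Lemma compact_finite_net (R : realType) (X : eqType) (Y : topologicalType)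
    (g : X -> Y -> R) (L : seq X) (e : R) :
  compact [set: Y] -> (forall x, continuous (g x)) -> 0 < e ->
  exists s : seq Y, forall y, exists2 z, z \in s &
    forall x, x \in L -> `|g x y - g x z| < e.
Proof.
move=> cY cg e0.
have [|s sP] := compact_finite_subcover
    (U := fun z => [set y | forall x, x \in L -> `|g x y - g x z| < e]) cY.
  move=> z _; apply: filter_all_seq => x _.
  by have /cvgrPdist_lt/(_ e e0) := cg x z; apply: filterS => y; rewrite distrC.
by exists s => y; exact: sP.
Qed.

(** If any two points of [Y] that are [d]-close at the test points [L] are
    [e]-close at every point of [V], then a finite net of [Y] for the
    pseudometric given by [L] controls all [g(-, y)] on [V], and continuity of
    the finitely many functions of the net gives [W].  Otherwise some pair
    violates this at one point, hence on an open set. *)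
Lemma small_oscillation_or_separation (R : realType) (X Y : topologicalType)
    (g : X -> Y -> R) (V : set X) (L : seq X) (d e : R) :
  compact [set: Y] -> (forall x, continuous (g x)) ->
  (forall x y, V x -> {for x, continuous (g^~ y)}) ->
  open V -> V !=set0 -> 0 < d -> 0 < e ->
  (exists W, [/\ open W, W !=set0, W `<=` V &
    forall x x' y, W x -> W x' -> `|g x y - g x' y| <= 3 * e]) \/
  (exists W y y', [/\ open W, W !=set0, W `<=` V,
    forall x, x \in L -> `|g x y - g x y'| <= d &
    forall x, W x -> e < `|g x y - g x y'|]).
Proof.
move=> cY cgx cgy oV [x0 Vx0] d0 e0.
have nV : nbhs x0 V by exact: open_nbhs_nbhs.
have [[x [y [y' [Vx yy' xyy']]]]|nsep] := pselect (exists x y y', [/\ V x,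
    forall p, p \in L -> `|g p y - g p y'| <= d & e < `|g x y - g x y'|]).
  right.
  have : nbhs x (V `&` [set z | e < `|g z y - g z y'|]).
    apply: filterI; first exact: open_nbhs_nbhs.
    have : {for x, continuous (fun z => `|g z y - g z y'|)}.
      apply: continuous_comp; last exact: norm_continuous.
      by apply: continuousB; exact: cgy.
    move=> /cvgrPdist_lt /(_ (`|g x y - g x y'| - e)).
    rewrite subr_gt0 => /(_ xyy'); apply: filterS => z /=.
    by rewrite ltr_norml => /andP[]; lra.
  rewrite nbhsE => -[W [oW Wx] WV]; exists W, y, y'; split=> //.
  - by exists x.
  - by move=> z /WV[].
  - by move=> z /WV[].
left.
have [s sP] := compact_finite_net L cY cgx d0.
have : nbhs x0 (V `&` [set x | forall z, z \in s -> `|g x0 z - g x z| < e / 2]).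
  apply: filterI => //; apply: filter_all_seq => z _.
  have e20 : 0 < e / 2 by lra.
  by have /cvgrPdist_lt /(_ _ e20) := cgy x0 z Vx0.
rewrite nbhsE => -[W [oW Wx0] WV]; exists W; split=> //.
- by exists x0.
- by move=> z /WV[].
move=> x x' y Wx Wx'.
have [z zs yz] := sP y.
have [Vx /(_ z zs) xz] := WV _ Wx; have [Vx' /(_ z zs) x'z] := WV _ Wx'.
have close u : V u -> `|g u y - g u z| <= e.
  move=> Vu; rewrite leNgt; apply/negP => uyz; apply: nsep.
  by exists u, y, z; split=> // p pL; exact/ltW/yz.
have := close _ Vx; have := close _ Vx'; move: xz x'z.
rewrite !ltr_norml !ler_norml => /andP[? ?] /andP[? ?] /andP[? ?] /andP[? ?].
by apply/andP; split; lra.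
Qed.

(** * Open sets in products of separable spaces *)

Lemma dense_sequence (T : topologicalType) (t0 : T) : separable_space T ->
  exists d : nat -> T, forall W, open W -> W !=set0 -> exists n, W (d n).
Proof.
move=> [D [cD dD]].
have [d dP] : exists d : nat -> T, D `<=` range d.
  have /countable_injP[h hinj] := cD.
  exists (fun n => xget t0 [set x | D x /\ h x = n]) => x Dx.
  exists (h x) => //; case: xgetP => [y _ [Dy hy]|/(_ x)]; last by case.
  by apply: hinj => //; exact/mem_set.
exists d => W oW W0; have [x [Wx /dP[n _ dn]]] := dD W W0 oW.
by exists n; rewrite dn.
Qed.

Section product_boxes.
Variables (I : eqType) (K : I -> topologicalType).
Let P : topologicalType := prod_topology K.

Lemma prod_box_nbhs (x : P) (S : seq I) (W : forall i, set (K i)) :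
  (forall i, i \in S -> nbhs (x i) (W i)) ->
  nbhs x [set p : P | forall i, i \in S -> W i (p i)].
Proof.
move=> xW; apply: (@filter_all_seq P I (nbhs x) (fun i p => W i (p i))) => i iS.
exact: (@proj_continuous I K i x _ (xW i iS)).
Qed.

Lemma prod_nbhs_box (x : P) (U : set P) : nbhs x U ->
  exists (S : seq I) (W : forall i, set (K i)), (forall i, nbhs (x i) (W i)) /\
    [set p : P | forall i, i \in S -> W i (p i)] `<=` U.
Proof.
pose F : set_system P := [set U | exists (S : seq I) (W : forall i, set (K i)),
  (forall i, nbhs (x i) (W i)) /\
    [set p : P | forall i, i \in S -> W i (p i)] `<=` U].
have FF : Filter F.
  split.
  - exists [::], (fun i => setT); split => // i; exact: filterT.
  - move=> A B [S [W [xW WA]]] [S' [W' [xW' WB]]].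
    exists (S ++ S'), (fun i => W i `&` W' i); split.
      by move=> i; exact: filterI.
    move=> p pW; split; [apply: WA|apply: WB] => i iS.
      by have [] := pW i; rewrite ?mem_cat ?iS.
    by have [] := pW i; rewrite ?mem_cat ?iS ?orbT.
  - move=> A B AB [S [W [xW WA]]]; exists S, W; split=> //.
    exact: subset_trans WA AB.
have : F --> x.
  apply/cvg_sup => i A [_ [[C oC <-] Cx] CA].
  (* Quantifying over all [p] with [p j = z] avoids transporting [C] along
     [j = i]; for [j != i] this is the whole factor. *)
  exists [:: i], (fun j => [set z | forall p : P, p j = z -> j = i -> C (p i)]).
  split=> [j|p pW].
    have [->|ji] := eqVneq j i.
      have : nbhs (x i) C by exact: open_nbhs_nbhs.
      by apply: filterS => z Cz p ->.
    by apply: nearW => z p _ /eqP; rewrite (negbTE ji).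
  by apply: CA => /=; apply: (pW i (mem_head _ _) p).
exact.
Qed.

Definition depends_on (B : set P) (S : seq I) :=
  forall x p, B x -> (forall i, i \in S -> p i = x i) -> B p.

Lemma open_contains_box (U : set P) : open U -> U !=set0 ->
  exists B S, [/\ open B, B !=set0, B `<=` U & depends_on B S].
Proof.
move=> oU [x Ux].
have [S [W [xW WU]]] := prod_nbhs_box (open_nbhs_nbhs (conj oU Ux)).
exists [set p : P | forall i, i \in S -> (W i)° (p i)], S; split.
- rewrite openE => p pW; apply: (@prod_box_nbhs p S (fun i => (W i)°)) => i iS.
  by apply: open_nbhs_nbhs; split; [exact: open_interior|exact: pW].
- by exists x => i _; exact: xW.
- by apply: subset_trans WU => p pW i iS; apply: interior_subset; exact: pW.
- by move=> y p yW py i iS; rewrite py//; exact: yW.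
Qed.

End product_boxes.

Section test_points.
Variables (I : eqType) (K : I -> topologicalType).
Variables (a : prod_topology K) (d : forall i, nat -> K i).

(** For [size c <= size S], a point equal to [a] off [S], whose coordinate at
    the [k]-th element of [S] is the [c_k]-th term of the dense sequence there.
    Coding by lists of naturals makes the points over a given [S] countable,
    whatever [I] is; and for [k >= size c] the coordinate is that of [a], so
    that a code keeps its meaning when [S] is extended. *)
Definition test_point (S : seq I) (c : seq nat) : prod_topology K :=
  fun i => if (index i S < size c)%N then d i (nth 0%N c (index i S)) else a i.

Lemma test_point_prefix (S S' : seq I) (c : seq nat) :
  prefix S S' -> (size c <= size S)%N -> test_point S' c = test_point S c.
Proof.
move=> /prefixP[N ->] cS; apply: functional_extensionality_dep => i.
rewrite /test_point index_cat; have [//|iS] := boolP (i \in S).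
by rewrite (memNindex iS) !ltnNge cS (leq_trans cS) ?leq_addr.
Qed.

End test_points.

Lemma compact_cluster_pairs (Y : topologicalType) (y y' : nat -> Y) :
  compact [set: Y] ->
  exists z : Y * Y, cluster ((fun n => (y n, y' n)) @ \oo) z.
Proof.
move=> cY.
have [|z [_ zP]] :=
  @compact_setX Y Y _ _ cY cY ((fun n => (y n, y' n)) @ \oo) _.
  by exists 0%N.
by exists z.
Qed.

Lemma cluster_eventually (R : realType) (Y : topologicalType) (u : nat -> Y)
    (h : Y -> R) (z : Y) (c : R) :
  cluster (u @ \oo) z -> {for z, continuous h} ->
  (\forall n \near \oo, h (u n) <= c) -> h z <= c.
Proof.
move=> uz hz uc; rewrite leNgt; apply/negP => chz.
have nz : nbhs z [set y | c < h y].
  have /cvgrPdist_lt /(_ (h z - c)) := hz.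
  rewrite subr_gt0 => /(_ chz); apply: filterS => y /=.
  by rewrite ltr_norml => /andP[]; lra.
have [y [/= hyc]] := uz [set y | h y <= c] _ uc nz.
by rewrite ltNge hyc.
Qed.

(** * Small oscillation on non-meager open sets *)

Section namioka.
Variables (R : realType) (I : eqType) (K : I -> topologicalType).
Let P : topologicalType := prod_topology K.
Variables (Y : topologicalType) (g : P -> Y -> R) (U : set P) (e : R).
Hypothesis Ksep : forall i, separable_space (K i).
Hypothesis cY : compact [set: Y].
Hypothesis cgx : forall x, continuous (g x).
Hypothesis cgy : forall x y, U x -> {for x, continuous (g^~ y)}.

(** The argument sketched at the top.  A state of the game is an open set, a
    list of coordinates, on which the set depends after the first move, and the
    number [n] of moves made; the next pair of points of [Y] must be
    [1/(n+1)]-close at the first [n+1] codes of test points over the current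
    list. *)
Lemma nonmeager_small_oscillation : open U -> ~ meager U -> 0 < e ->
  exists W, [/\ open W, W !=set0, W `<=` U &
    forall x x' y, W x -> W x' -> `|g x y - g x' y| <= 3 * e].
Proof.
move=> oU nmU e0; apply: contrapT => nW.
have [a Ua] : U !=set0.
  apply/set0P/eqP => U0; apply: nmU; exists (fun=> set0); split.
    by move=> _; rewrite /nowhere_dense closure0 interior0.
  by rewrite U0 bigcup0.
pose d i := sval (cid (dense_sequence (a i) (Ksep i))).
have dP i := svalP (cid (dense_sequence (a i) (Ksep i))).
pose pt S l := test_point a d S (odflt [::] (unpickle l)).
pose h x (y : Y * Y) := `|g x y.1 - g x y.2|.
pose A := (set P * seq I * nat)%type.
pose step (s t : A) := [/\ t.2 = s.2.+1, t.1.1 `<=` U, prefix s.1.2 t.1.2,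
  depends_on t.1.1 t.1.2 &
  exists y : Y * Y,
    (forall l, (l <= s.2)%N -> h (pt s.1.2 l) y <= s.2.+1%:R^-1) /\
    (forall x, t.1.1 x -> e < h x y)].
have [s V oV V0 VO VU|s [x [s0 sM sx]]] :=
  @oxtoby P A (fun s => s.1.1) step (U, [::], 0%N) oU nmU.
  have VN W : ~ [/\ open W, W !=set0, W `<=` V &
    forall x x' y, W x -> W x' -> `|g x y - g x' y| <= 3 * e].
    move=> [oW W0 WV sW]; apply: nW; exists W; split=> //.
    exact: subset_trans WV VU.
  pose L := [seq pt s.1.2 l | l <- iota 0 s.2.+1].
  have d0 : (0 : R) < s.2.+1%:R^-1 by rewrite invr_gt0 ltr0n.
  have cgyV x y : V x -> {for x, continuous (g^~ y)} by move=> /VU; exact: cgy.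
  have [[W /VN//]|] :=
    small_oscillation_or_separation L cY cgx cgyV oV V0 d0 e0.
  move=> [W [y [y' [oW W0 WV Lyy' Wyy']]]].
  have [B [S [oB B0 BW BS]]] := open_contains_box oW W0.
  exists (B, s.1.2 ++ S, s.2.+1); split=> //=; last exact: subset_trans BW WV.
  split=> //=.
  - by apply: subset_trans VU; exact: subset_trans BW WV.
  - exact: prefix_prefix.
  - move=> z p Bz zp; apply: (BS z) => // i iS; apply: zp.
    by rewrite mem_cat iS orbT.
  - exists (y, y'); split=> [l ls|z /BW]; last exact: Wyy'.
    by apply: Lyy'; apply: map_f; rewrite mem_iota.
have /choice[y yP] n := let: And5 _ _ _ _ h := sM n in h.
have sn n : (s n).2 = n.
  by elim: n => [|n IHn]; [rewrite s0|have [->] := sM n; rewrite IHn].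
have prefS m n : (m <= n)%N -> prefix (s m).1.2 (s n).1.2.
  move=> /subnK <-; elim: (n - m)%N => [|k IHk]; first by rewrite prefix_refl.
  by rewrite addSn; have [_ _ ? _ _] := sM (k + m)%N; exact: prefix_trans IHk _.
have subS m n : (m <= n)%N -> {subset (s m).1.2 <= (s n).1.2}.
  by move=> /prefS/prefixP[N ->] i iS; rewrite mem_cat iS.
(* The common point [x] is reset to [a] outside the coordinates in play. *)
pose J i := exists n, i \in (s n).1.2.
pose xt : P := fun i => if pselect (J i) then x i else a i.
have Bxt n : (s n.+1).1.1 xt.
  have [_ _ _ dep _] := sM n; apply: (dep x) => // i iS.
  by rewrite /xt; case: pselect => // nJ; exfalso; apply: nJ; exists n.+1.
have [z zP] := compact_cluster_pairs (fst \o y) (snd \o y) cY.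
have yE : (fun n => ((fst \o y) n, (snd \o y) n)) = y.
  by apply: funext => n /=; rewrite -surjective_pairing.
rewrite yE in zP.
have hc p : {for z, continuous (h p)}.
  apply: continuous_comp; last exact: norm_continuous.
  by apply: continuousB; apply: continuous_comp;
    [exact: cvg_fst|exact: cgx|exact: cvg_snd|exact: cgx].
have hxt : e <= h xt z.
  rewrite -lerN2; apply: (cluster_eventually zP (h := fun w => - h xt w)).
    exact: continuousN.
  apply: nearW => n; rewrite lerN2; apply/ltW.
  by have [_] := yP n; exact.
(* A code is tested, with the same meaning, at all late enough stages. *)
have hpt m c : (size c <= size (s m).1.2)%N ->
    h (test_point a d (s m).1.2 c) z <= 0.
  move=> cm; apply/ler_addgt0Pl => r r0; rewrite addr0.
  apply: (cluster_eventually zP) => //.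
  near=> n.
  have mn : (m <= n)%N by near: n; exists m.
  have cn : (pickle c <= n)%N by near: n; exists (pickle c).
  have [/(_ (pickle c)) + _] := yP n; rewrite sn => /(_ cn).
  rewrite /pt pickleK /= (test_point_prefix _ _ (prefS _ _ mn) cm).
  move=> /le_trans; apply; apply/ltW; near: n.
  exact: (near_infty_natSinv_lt (PosNum r0)).
have Uxt : U xt by have [_ /(_ xt (Bxt 0%N))] := sM 0%N.
have [G [W [xtW GW]]] : exists (S : seq I) (W : forall i, set (K i)),
    (forall i, nbhs (xt i) (W i)) /\
    [set p : P | forall i, i \in S -> W i (p i)] `<=` [set p | 0 < h p z].
  apply: prod_nbhs_box.
  have : {for xt, continuous (h^~ z)}.
    apply: continuous_comp; last exact: norm_continuous.
    by apply: continuousB; exact: cgy.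
  move=> /cvgrPdist_lt /(_ e e0); apply: filterS => p /=.
  by rewrite ltr_norml => /andP[_]; lra.
(* A test point in the box [G, W]: off [J] the coordinates of [xt] are already
   those of [a], and the part of [G] in [J] appears at a finite stage. *)
have [m mP] : exists m, forall i, i \in G -> J i -> i \in (s m).1.2.
  elim: (G) => [|i S [m mP]]; first by exists 0%N.
  have [[k iSk]|nJ] := pselect (J i).
    exists (maxn m k) => j; rewrite in_cons => /predU1P[->|jS] Jj.
      exact: subS (leq_maxr m k) _ iSk.
    exact: subS (leq_maxl m k) _ (mP _ jS Jj).
  by exists m => j; rewrite in_cons => /predU1P[->//|]; exact: mP.
have /choice[nu nuP] i : exists n, W i (d i n).
  have [|n /interior_subset] := dP i _ (@open_interior _ (W i));
    last by exists n.
  by exists (xt i); exact: xtW.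
have /GW : forall i, i \in G ->
    W i (test_point a d (s m).1.2 (map nu (s m).1.2) i).
  move=> i iG; rewrite /test_point size_map index_mem; case: ifPn => im.
    by rewrite (nth_map i) ?index_mem// nth_index.
  have := nbhs_singleton (xtW i); rewrite /xt; case: pselect => // Ji.
  by move: im; rewrite mP.
by rewrite /= ltNge hpt // size_map.
Unshelve. all: by end_near. Qed.
End namioka.

(** * Joint continuity off a meager set *)

Lemma meager_bigcup (X : topologicalType) (A : nat -> set X) :
  (forall n, meager (A n)) -> meager (\bigcup_n A n).
Proof.
move=> /choice[F FP].
exists (fun l => if unpickle l is Some (n, k) then F n k else set0); split.
  move=> l; case: unpickle => [[n k]|]; first exact: (FP n).1.
  by rewrite /nowhere_dense closure0 interior0.
apply/seteqP; split=> [x [n _]|x [l _]].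
  by rewrite (FP n).2 => -[k _ Fx]; exists (pickle (n, k)); rewrite ?pickleK.
case: unpickle => [[n k] Fx|//]; exists n => //.
by rewrite (FP n).2; exists k.
Qed.

Lemma nowhere_dense_meager (X : topologicalType) (A : set X) :
  nowhere_dense A -> meager A.
Proof.
move=> ndA; exists (fun=> A); split=> //.
by rewrite bigcup_const//; exists 0%N.
Qed.

Lemma open_preimage_meager (S T : topologicalType) (j : S -> T) (A : set T) :
  continuous j -> (forall U, open U -> open (j @` U)) ->
  meager A -> meager (j @^-1` A).
Proof.
move=> cj oj [F [ndF ->]]; exists (fun n => j @^-1` (F n)); split; last first.
  by rewrite preimage_bigcup.
move=> n; apply/nowhere_denseP => V oV [v Vv].
have /nowhere_denseP /(_ _ (oj _ oV)) [|W [oW [w Ww] WV WF]] := ndF n.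
  by exists (j v), v.
exists (V `&` j @^-1` W); split.
- by apply: openI => //; move/continuousP: cj; exact.
- by have [u Vu uw] := WV _ Ww; exists u; rewrite /= uw.
- by move=> ? [].
- rewrite -subset0 => z [[_ Wz] Fz].
  by have : (W `&` F n) (j z) by []; rewrite WF.
Qed.

(** Transfer to a space openly embedded in a product.  The function is extended
    to the whole product in the first variable by a left inverse of [j], which
    is continuous at the points of the image; the test points may then lie
    anywhere in the product. *)
Lemma small_oscillation_embedding (R : realType) (I : Type)
    (K : I -> topologicalType) (X Y : topologicalType)
    (j : X -> prod_topology K) (f : X * Y -> R) (U : set X) (e : R) :
  (forall i, separable_space (K i)) ->
  continuous j -> injective j -> (forall V, open V -> open (j @` V)) ->
  compact [set: Y] -> separately_continuous f ->
  open U -> ~ meager U -> 0 < e ->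
  exists V, [/\ open V, V !=set0, V `<=` U &
    forall x x' y, V x -> V x' -> `|f (x, y) - f (x', y)| <= 3 * e].
Proof.
move=> Ksep cj injj oj cY [fx fy] oU nmU e0.
have nmjU : ~ meager (j @` U).
  move=> /(open_preimage_meager cj oj).
  by move=> /(subset_meager (@preimage_image _ _ j U)).
have [u Uu] : U !=set0.
  apply/set0P/eqP => U0; apply: nmU; rewrite U0.
  by apply: nowhere_dense_meager; rewrite /nowhere_dense closure0 interior0.
pose r p := xget u [set x | j x = p].
have rK x : r (j x) = x.
  by rewrite /r; case: xgetP => [z _ /injj//|/(_ x)]; case.
have [x|_ y [t Ut <-] A|W [oW [w Ww] WU Wsmall]] :=
    @nonmeager_small_oscillation R {classic I} K Y (fun p y => f (r p, y))
    (j @` U) e Ksep cY _ _ (oj _ oU) nmjU e0.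
- exact: fx.
- rewrite /=; rewrite rK => /fy; rewrite !nbhsE.
  move=> -[V [oV Vt] VA]; exists (j @` V); first by split; [exact: oj|exists t].
  by move=> _ [v Vv <-] /=; rewrite rK; exact: VA.
exists (j @^-1` W); split.
- by move/continuousP: cj; exact.
- by have [v Uv vw] := WU _ Ww; exists v; rewrite /= vw.
- by move=> x /WU[v Uv /injj <-].
- by move=> x x' y Wx Wx'; have := Wsmall _ _ y Wx Wx'; rewrite !rK.
Qed.

(** An open set disjoint from the open set [C] of points of small oscillation
    is meager, by hypothesis; so the complement of [closure C] is meager, and
    the boundary of an open set is nowhere dense. *)
Lemma meager_oscillation (R : realType) (X Y : topologicalType)
    (f : X * Y -> R) (e : R) :
  (forall U, open U -> ~ meager U -> exists V, [/\ open V, V !=set0, V `<=` U &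
    forall x x' y, V x -> V x' -> `|f (x, y) - f (x', y)| <= e]) ->
  meager (~` [set x | exists V, [/\ open V, V x &
    forall x x' y, V x -> V x' -> `|f (x, y) - f (x', y)| <= e]]).
Proof.
set C := [set x | _] => H.
have oC : open C.
  rewrite openE => x [V [oV Vx VP]]; rewrite /interior nbhsE; exists V => //.
  by move=> z Vz; exists V.
have mU : meager (~` closure C).
  apply: contrapT => /(H _ (closed_openC (@closed_closure _ C))).
  move=> [V [oV [v Vv] VC VP]]; apply: (VC v Vv); apply: subset_closure.
  by exists V.
have ndB : nowhere_dense (closure C `\` C).
  apply/nowhere_denseP => V oV V0.
  have [VC|VC] := eqVneq (V `&` C) set0.
    exists V; split=> //; rewrite -subset0 => v [Vv [Cv _]].
    have : V `&` C !=set0 by apply: open_meets_closure => //; exists v.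
    by rewrite VC => -[].
  exists (V `&` C); split; [exact: openI|exact/set0P|by move=> ? []|].
  by rewrite -subset0 => v [[_ ?] []].
apply: (@subset_meager _ _
  (\bigcup_n (if n is 0%N then ~` closure C else closure C `\` C))).
  move=> x nCx; have [cx|ncx] := pselect (closure C x); last by exists 0%N.
  by exists 1%N.
by apply: meager_bigcup => -[//|n]; exact: nowhere_dense_meager.
Qed.

Lemma meager_joint_discontinuity (R : realType) (X Y : topologicalType)
    (f : X * Y -> R) :
  separately_continuous f ->
  (forall (U : set X) (e : R), open U -> ~ meager U -> 0 < e ->
    exists V, [/\ open V, V !=set0, V `<=` U &
      forall x x' y, V x -> V x' -> `|f (x, y) - f (x', y)| <= e]) ->
  exists2 M, meager M &
    forall x y, ~ M x -> {for (x, y), continuous f}.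
Proof.
move=> [fx fy] H.
pose C (e : R) := [set x | exists V, [/\ open V, V x &
    forall x x' y, V x -> V x' -> `|f (x, y) - f (x', y)| <= e]].
exists (\bigcup_n ~` C n.+1%:R^-1).
  apply: meager_bigcup => n; apply: meager_oscillation => U oU nmU.
  by apply: H => //; rewrite invr_gt0 ltr0n.
move=> x y nM; apply/cvgrPdist_lt => e e0.
have e20 : 0 < e / 2 by lra.
have [n _ /(_ n (leqnn n)) /= ne] := near_infty_natSinv_lt (PosNum e20).
have [V [oV Vx VP]] : C n.+1%:R^-1 x.
  by apply: contrapT => nC; apply: nM; exists n.
have /cvgrPdist_lt /(_ _ e20) yP := fx x y.
exists (V, [set z | `|f (x, y) - f (x, z)| < e / 2]).
  by split=> //=; exact: open_nbhs_nbhs.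
move=> [u v] [/= Vu Vy]; rewrite /= in Vy.
have xv := le_lt_trans (VP _ _ v Vx Vu) ne.
have -> : f (x, y) - f (u, v) =
    (f (x, y) - f (x, v)) + (f (x, v) - f (u, v)) by ring.
apply: le_lt_trans (ler_normD _ _) _.
by rewrite (splitr e) ltrD.
Qed.

(** * Separately continuous functions discontinuous over a meager set *)

Lemma discrete_compact_finite (I : choiceType)
    (C : set (discrete_topology I)) :
  compact C -> exists s : seq I, forall i, C i -> i \in s.
Proof.
move=> cC.
have [|s sP] := compact_finite_subcover (U := fun i => [set i]) cC.
  by move=> i _.
by exists s => i /sP[j js ->].
Qed.

(** A pointwise null family [u] extends by zero at infinity to a separately
    continuous function on [X] times the one-point compactification of its
    index set.  Joint continuity at [(x, oo)] would make all but finitely many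
    [u i] uniformly small near [x]. *)
Lemma c0_family_discontinuity (R : realType) (X : topologicalType)
    (I : choiceType) (u : I -> X -> R) :
  (forall i, continuous (u i)) ->
  (forall x e, 0 < e -> exists s : seq I, forall i, e <= `|u i x| -> i \in s) ->
  exists (Y : topologicalType) (f : X * Y -> R) (y : Y),
    [/\ compact [set: Y], separately_continuous f &
      forall x c, 0 < c ->
        (forall U (s : seq I), nbhs x U ->
          exists i z, [/\ i \notin s, U z & c <= `|u i z|]) ->
        ~ {for (x, y), continuous f}].
Proof.
move=> cu u0.
pose Y : topologicalType := one_point_compactification (discrete_topology I).
pose f (p : X * Y) : R := if p.2 is Some i then u i p.1 else 0.
exists Y, f, None; split.
- exact: one_point_compactification_compact.
- split=> [x [i|]|[i|]]; last 2 first.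
  + exact: cu.
  + exact: cst_continuous.
  + move=> A /nbhs_singleton fA.
    have : nbhs (i : discrete_topology I) [set i] by [].
    move=> /one_point_compactification_some_nbhs iN.
    by apply: (@filterS Y (nbhs (Some i : Y)) _ _ _ _ iN) => _ [_ -> <-].
  + apply/(@cvgrPdist_lt _ _ _ (nbhs (None : Y)) (nbhs_filter _)) => e e0.
    have [s sP] := u0 x e e0.
    exists [set` s].
      split; last exact: discrete_closed.
      by apply: finite_compact; exact: finite_seq.
    move=> _ [[i /= is_ <-]|->]; rewrite /f /= sub0r normrN ?normr0//.
    by rewrite ltNge; apply/negP => /sP/is_.
- move=> x c c0 H /cvgrPdist_lt /(_ c c0) [[A B] [/= xA [C [cC _] CB]] AB].
  have [s sP] := discrete_compact_finite cC.
  have [i [z [is_ Az]]] := H A s xA.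
  rewrite leNgt => /negP; apply.
  have := AB (z, Some i); rewrite /f /= sub0r normrN; apply; split=> //=.
  by apply: CB; left; exists i => // /sP; exact/negP.
Qed.

(** For [k > 0], a tent with apex at [3 / k], supported between [1 / k] and
    [5 / k]: it vanishes near zero, yet it is wide enough that, with [k] the
    integer part of [3 / t], it is at least [1/2] at [t] when [0 < t <= 1]. *)
Definition tent (R : realType) (k : nat) (t : R) : R :=
  Num.max 0 (1 - `|k%:R * t - 3| / 2).

Section tent.
Variable R : realType.
Implicit Types t : R.

Lemma tent_continuous k : continuous (@tent R k).
Proof.
move=> t.
apply: (@continuous_max R R (fun=> 0) (fun t => 1 - `|k%:R * t - 3| / 2)).
  exact: cst_continuous.
apply: continuousB; first exact: cst_continuous.
apply: continuousM; last exact: cst_continuous.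
apply: continuous_comp; last exact: norm_continuous.
apply: continuousB; last exact: cst_continuous.
by apply: continuousM => //; exact: cst_continuous.
Qed.

Lemma tent_ge0 k t : 0 <= tent k t.
Proof. by rewrite le_max lexx. Qed.

Lemma tent_le1 k t : tent k t <= 1.
Proof.
rewrite ge_max ler01 /=.
have := normr_ge0 (k%:R * t - 3); lra.
Qed.

Lemma tent_eq0 k t : k%:R * t <= 1 \/ 5 <= k%:R * t -> tent k t = 0.
Proof.
move=> kt; apply/max_idPl; have [] := kt.
  by have := ler_norm (- (k%:R * t - 3)); rewrite normrN; lra.
by have := ler_norm (k%:R * t - 3); lra.
Qed.

Lemma tent_cover t : 0 < t -> t <= 1 -> exists k, 1 / 2 <= tent k t.
Proof.
move=> t0 t1; exists (Num.trunc (3 / t)); rewrite le_max; apply/orP; right.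
have /truncn_itv/andP[] : 0 <= 3 / t by rewrite divr_ge0 ?ler0n// ltW.
set k := Num.trunc _; rewrite ler_pdivlMr// ltr_pdivrMr//.
rewrite -[k.+1%:R]natr1 mulrDl => k1 k2.
suff : `|k%:R * t - 3| <= 1 by lra.
by rewrite ler_norml; apply/andP; split; lra.
Qed.
End tent.

(** The indices are triples [(n, h, k)] with [h] in a maximal family [A n] of
    disjointly supported functions vanishing on [F n].  At a given point each
    level [n] has at most one nonzero [h] and finitely many nonzero tents
    [tent k (h x)], and the factor [1/(n+1)] leaves finitely many levels above
    a threshold.  Each function of level [n] vanishes near each point of [F n],
    while by maximality every nonempty open set contains a point where some [h]
    of that level is nonzero. *)
Lemma nowhere_dense_discontinuity (R : realType) (X : topologicalType)
    (F : nat -> set X) :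
  (forall (x : X) (U : set X), nbhs x U ->
    exists f : X -> R, [/\ continuous f, forall z, f z \in `[0, 1],
      f x = 0 & forall z, ~ U z -> f z = 1]) ->
  (forall n, nowhere_dense (F n)) ->
  exists (Y : topologicalType) (f : X * Y -> R) (y : Y),
    [/\ compact [set: Y], separately_continuous f &
      forall x, (\bigcup_n F n) x -> ~ {for (x, y), continuous f}].
Proof.
move=> cr ndF.
pose P n : set (X -> R) := [set h : X -> R | [/\ continuous h,
  forall z, 0 <= h z <= 1 & forall z, F n z -> h z = 0]].
pose O (h : X -> R) := [set z | h z != 0].
have /choice[A AP] n := maximal_disjoint_family (P n) O.
have AinP n : A n `<=` P n by have [] := AP n.
have Apos n h z : A n h -> h z != 0 -> 0 < h z.
  by move=> /AinP[_ /(_ z)/andP[h0 _] _] hz; rewrite lt_def hz.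
pose I := {classic (nat * (X -> R) * nat)}.
pose u (i : I) z : R :=
  if pselect (A i.1.1 i.1.2) then i.1.1.+1%:R^-1 * tent i.2 (i.1.2 z) else 0.
have cu i : continuous (u i).
  rewrite /u; case: pselect => [Ai|nAi] z; last exact: cst_continuous.
  have [ch _ _] := AinP _ _ Ai.
  apply: cvgM; first exact: cvg_cst.
  by apply: continuous_comp; [exact: ch|exact: tent_continuous].
have u0 x e : 0 < e -> exists s : seq I, forall i, e <= `|u i x| -> i \in s.
  move=> e0.
  (* The only member of [A n] not vanishing at [x], if there is one. *)
  pose h n : X -> R := xget (fun=> 0) [set h | A n h /\ h x != 0].
  pose N := (Num.trunc e^-1).+1; pose M n := (Num.trunc (5 / h n x)).+1.
  have [s sP] : exists s : seq I, forall n k,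
      (n < N)%N -> (k < M n)%N -> ((n, h n, k) : I) \in s.
    exists [seq ((n, h n, k) : I) | n <- iota 0 N, k <- iota 0 (M n)].
    move=> n k nN kM.
    by apply: (@allpairs_f_dep nat (fun=> nat) I (fun n k => (n, h n, k)));
      rewrite mem_iota.
  exists s.
  move=> [[n t] k]; rewrite /u /=; case: pselect => [At|nAt]; last first.
    by rewrite normr0 leNgt e0.
  have n0 : (0 : R) < n.+1%:R^-1 by rewrite invr_gt0 ltr0n.
  rewrite normrM !ger0_norm ?tent_ge0 ?(ltW n0)// => en.
  have tent0 : tent k (t x) != 0.
    by apply/eqP => E; move: en; rewrite E mulr0 leNgt e0.
  have tx : t x != 0.
    by apply: contra_neq tent0 => ->; apply: tent_eq0; left; rewrite mulr0.
  have htn : t = h n.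
    rewrite /h; case: xgetP => [t' _ [At' t'x]|/(_ t)]; last by case.
    have [_ + _] := AP n; apply=> //.
    by exists x.
  have tx0 := Apos _ _ _ At tx.
  rewrite [t in (_, t, _)]htn; apply: sP; rewrite ltnS truncn_ge_nat.
  - have : e <= n.+1%:R^-1.
      by apply: le_trans en _; rewrite -[leRHS]mulr1 ler_pM2l// tent_le1.
    rewrite -lef_pV2 ?posrE// invrK; apply: le_trans.
    by rewrite ler_nat.
  - by rewrite invr_ge0 ltW.
  - rewrite -htn ler_pdivlMr// leNgt; apply: contra_neqN tent0 => /ltW t5.
    by apply: tent_eq0; right.
  - by rewrite -htn divr_ge0 ?(ltW tx0).
have [Y [f [y [cY scf fdisc]]]] := c0_family_discontinuity cu u0.
exists Y, f, y; split=> // x [n _ Fx].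
have n0 : (0 : R) < n.+1%:R^-1 by rewrite invr_gt0 ltr0n.
apply: (fdisc _ (n.+1%:R^-1 * (1 / 2))) => [|U s xU].
  by rewrite mulr_gt0//; lra.
have : nbhs x (U `&` [set z | forall i, i \in s -> i.1.1 = n -> u i z = 0]).
  apply: filterI => //; apply: filter_all_seq => i _.
  rewrite /u; case: pselect => [Ai|nAi]; last exact: nearW.
  have [iN|/eqP iN] := eqVneq i.1.1 n; last exact: nearW.
  have [ch _ h0] := AinP _ _ Ai.
  have hx : i.1.2 x = 0 by apply: h0; rewrite iN.
  have k0 : (0 : R) < i.2.+1%:R^-1 by rewrite invr_gt0 ltr0n.
  have /cvgrPdist_lt /(_ _ k0) := ch x; apply: filterS => z /= hz _.
  rewrite tent_eq0 ?mulr0//; left.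
  move: hz; rewrite hx sub0r normrN => /(le_lt_trans (ler_norm _)) /ltW hz.
  apply: le_trans (_ : i.2%:R * i.2.+1%:R^-1 <= 1).
    by rewrite ler_wpM2l ?ler0n.
  by rewrite ler_pdivrMr ?ltr0n// mul1r ler_nat.
rewrite nbhsE => -[V [oV Vx] VU].
have /nowhere_denseP /(_ V oV (ex_intro _ x Vx)) [W [oW [w Ww] WV WF]] := ndF n.
have [g [cg g01 gw gW]] := cr w W (open_nbhs_nbhs (conj oW Ww)).
have [_ _ /(_ (fun z => 1 - g z))[||t At [z [gz tz]]]] := AP n.
- split.
  + move=> z; apply: continuousB; [exact: cst_continuous|exact: cg].
  + move=> z; have := g01 z; rewrite in_itv /= => /andP[? ?].
    by apply/andP; split; lra.
  + move=> z Fz; rewrite gW ?subrr// => Wz.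
    by have : (W `&` F n) z by []; rewrite WF.
- by exists w; rewrite /O /= gw subr0 oner_neq0.
have Wz : W z by apply: contrapT => /gW E; move: gz; rewrite /O /= E subrr eqxx.
have [k kP] : exists k, 1 / 2 <= tent k (t z).
  apply: tent_cover; first exact: Apos At tz.
  by have [_ /(_ z)/andP[]] := AinP _ _ At.
pose i : I := (n, t, k).
have uiz : n.+1%:R^-1 * (1 / 2) <= `|u i z|.
  rewrite /u /=; case: pselect => [At0|//].
  by rewrite ger0_norm ?mulr_ge0 ?tent_ge0 ?(ltW n0)// ler_pM2l.
have [Uz sz] := VU _ (WV _ Wz).
exists i, z; split=> //; apply/negP => /sz /(_ erefl) ui0.
by move: uiz; rewrite ui0 normr0 leNgt mulr_gt0//; lra.
Qed.

(** * The two equivalences *)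

Lemma Pi_separable_joint_continuity (R : realType) (Z : topologicalType)
    (X : set Z) (Y : topologicalType) (f : set_type X * Y -> R) :
  Pi_separable Z -> open X -> compact [set: Y] -> separately_continuous f ->
  exists2 M : set (set_type X), meager M &
    forall x y, ~ M x -> {for (x, y), continuous f}.
Proof.
move=> [I [K [Ksep [h [g [ch cg hK gK]]]]]] oX cY scf.
apply: meager_joint_discontinuity => // U e oU nmU e0.
pose j (x : set_type X) : prod_topology K := h (set_val x).
have cj : continuous j.
  by move=> x; apply: continuous_comp; [exact: initial_continuous|exact: ch].
have injj : injective j.
  by move=> x x' /(can_inj hK); rewrite set_valE; exact: val_inj.
have oj V : open V -> open (j @` V).
  move=> [A oA <-]; rewrite (_ : j @` _ = g @^-1` (A `&` X)).
    by move/continuousP: cg; apply; exact: openI.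
  apply/seteqP; split=> [_ [x Ax <-]|p [Ap Xp]] /=.
    by rewrite /j hK; split=> //; rewrite set_valE; exact: set_valP.
  by exists (exist _ (g p) (mem_set Xp)) => //; rewrite /j set_valE /= gK.
have e30 : 0 < e / 3 by rewrite divr_gt0.
have [V [oV V0 VU VP]] :=
  small_oscillation_embedding Ksep cj injj oj cY scf oU nmU e30.
exists V; split=> // x x' y Vx Vx'.
by have := VP x x' y Vx Vx'; rewrite mulrC divfK// pnatr_eq0.
Qed.

Lemma completely_regular_subspace (R : realType) (Z : topologicalType)
    (X : set Z) : completely_regular_space Z ->
  forall (x : set_type X) (U : set (set_type X)), nbhs x U ->
    exists f : set_type X -> R, [/\ continuous f, forall z, f z \in `[0, 1],
      f x = 0 & forall z, ~ U z -> f z = 1].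
Proof.
move=> /(@completely_regular_spaceP R) crZ x U [_ [[A oA <-] Ax] AU].
have [f [cf f01 fx f1]] := crZ _ _ (open_nbhs_nbhs (conj oA Ax)).
exists (f \o set_val); split=> //=.
- by move=> z; apply: continuous_comp; [exact: initial_continuous|exact: cf].
- by move=> z nUz; apply: f1 => /AU.
Qed.

(* [set_type X] carries the subspace topology (initial for the inclusion). *)
Theorem theorem7p6 (R : realType) (Z : topologicalType) (X : set Z)
    (Zcr : completely_regular_space Z) (Zsep : Pi_separable Z)
    (Xopen : open X) :
  (Baire_space (set_type X) <-> N_space R (set_type X)) /\
  (~ meager [set: set_type X] <-> gN_space R (set_type X)).
Proof.
have crX := @completely_regular_subspace R Z X Zcr.
split; split.
- move=> baireX Y f cY scf.
  have [M mM fM] := Pi_separable_joint_continuity Zsep Xopen cY scf.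
  exists (~` M); split; last by move=> x y; exact: fM.
  move=> U U0 oU; apply: contrapT => UM; apply: (baireX U oU U0).
  apply: subset_meager mM => x Ux; apply: contrapT => nMx.
  by apply: UM; exists x.
- move=> NX U oU [x Ux] [F [ndF UE]].
  have [Y [f [y [cY scf fdisc]]]] := nowhere_dense_discontinuity crX ndF.
  have [D [dD fD]] := NX Y f cY scf.
  have [z [Uz Dz]] := dD U (ex_intro _ x Ux) oU.
  by apply: (fdisc z); [rewrite -UE|exact: fD].
- move=> nmX Y f cY scf.
  have [M mM fM] := Pi_separable_joint_continuity Zsep Xopen cY scf.
  apply: contrapT => nx; apply: nmX; apply: subset_meager mM => x _.
  by apply: contrapT => nMx; apply: nx; exists x => y; exact: fM.
- move=> gNX [F [ndF XE]].
  have [Y [f [y [cY scf fdisc]]]] := nowhere_dense_discontinuity crX ndF.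
  have [x fx] := gNX Y f cY scf.
  by apply: (fdisc x); rewrite -?XE.
Qed.
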